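(* For every $\varepsilon\in(0,\tfrac14]$ there are finite LMCs $\mathcal{M}$ and $\mathcal{N}$ with $\mathcal{M}\sim_\varepsilon\mathcal{N}$ but $\mathcal{M}\not\simeq_{1/4}\mathcal{N}$.
   Context: Fix a countable set $AP$ of atomic propositions. A labeled Markov chain (LMC) $\mathcal{M}=(S,P,s_{init},l)$ has a countable nonempty state set $S$, a transition function $P\colon S\to Distr(S)$ ($Distr(S)$ is the set of probability distributions on $S$), an initial state $s_{init}\in S$ and a labeling $l\colon S\to 2^{AP}$. It is finite if $S$ is finite. For $A\subseteq S$, $P(s)(A)=\sum_{t\in A}P(s)(t)$. The direct sum $\mathcal{M}\oplus\mathcal{N}$ is the LMC on the disjoint union of the state spaces with inherited transitions and labels (its initial state is irrelevant). For $R\subseteq S\times S$ and $A\subseteq S$ let $R(A)=\{t\mid\exists s\in A\colon(s,t)\in R\}$. A reflexive and symmetric $R$ is an $\varepsilon$-bisimulation if for all $(s,t)\in R$ and all $A\subseteq S$: $l(s)=l(t)$ and $P(s)(A)\le P(t)(R(A))+\varepsilon$. $s\sim_\varepsilon t$ if $(s,t)\in R$ for some $\varepsilon$-bisimulation $R$; $\mathcal{M}\sim_\varepsilon\mathcal{N}$ if $s_{init}^{\mathcal{M}}\sim_\varepsilon s_{init}^{\mathcal{N}}$ in $\mathcal{M}\oplus\mathcal{N}$. An equivalence $R\subseteq S\times S$ is a (probabilistic) bisimulation on $\mathcal{M}$ if for all $(s,t)\in R$ and all $R$-equivalence classes $C$: $l(s)=l(t)$ and $P(s)(C)=P(t)(C)$.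 A $\delta$-perturbation of $\mathcal{M}=(S,P,s_{init},l)$ is an LMC $\mathcal{M}'=(S,P',s_{init},l)$ with $\|P(s)-P'(s)\|_1=\sum_{t\in S}|P(s)(t)-P'(s)(t)|\le\delta$ for all $s\in S$. An equivalence $R$ on $S$ is a $\delta$-perturbed bisimulation on $\mathcal{M}$ if there is a $\delta$-perturbation $\mathcal{M}'$ of $\mathcal{M}$ such that $R$ is a bisimulation on $\mathcal{M}'$. $s\simeq_\delta t$ if $(s,t)\in R$ for some $\delta$-perturbed bisimulation $R$; $\mathcal{M}\simeq_\delta\mathcal{N}$ if $s_{init}^{\mathcal{M}}\simeq_\delta s_{init}^{\mathcal{N}}$ in $\mathcal{M}\oplus\mathcal{N}$. *)

(* Defs.v *)
From Stdlib Require Import RelationClasses.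
From mathcomp Require Import all_boot all_order all_algebra.
From mathcomp Require Import all_classical all_reals ereal esum.
Set Implicit Arguments.
Unset Strict Implicit.
Unset Printing Implicit Defensive.
Import Order.TTheory GRing.Theory Num.Theory.
Local Open Scope classical_set_scope.
Local Open Scope ring_scope.

Record distr (R : realType) (S : countType) := Distr {
  mass :> S -> R;
  mass_ge0 : forall s, 0 <= mass s;
  mass_sum1 : (\esum_(s in [set: S]) (mass s)%:E = 1)%E }.

(* [probm d A] is d(A), written with values in \bar R because \esum is. *)
Definition probm (R : realType) (S : countType) (d : distr R S) (A : set S)
  : \bar R := (\esum_(s in A) (d s)%:E)%E.

Definition l1_dist (R : realType) (S : countType) (d d' : distr R S) : \bar R :=
  (\esum_(s in [set: S]) `|d s - d' s|%:E)%E.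

Section DirectSumDistr.
Context (R : realType) (S T : countType).

Definition inl_mass (d : distr R S) (u : S + T) : R :=
  if u is inl s then d s else 0.

Definition inr_mass (d : distr R T) (u : S + T) : R :=
  if u is inr t then d t else 0.

Lemma inl_mass_ge0 d u : 0 <= inl_mass d u.
Proof. by case: u => //= s; exact: mass_ge0. Qed.

Lemma inr_mass_ge0 d u : 0 <= inr_mass d u.
Proof. by case: u => //= t; exact: mass_ge0. Qed.

Lemma inl_mass_sum1 d : (\esum_(u in [set: S + T]) (inl_mass d u)%:E = 1)%E.
Proof.
rewrite (@esumID _ _ (range inl)) => [|u _]; last first.
  by rewrite lee_fin inl_mass_ge0.
rewrite [X in (_ + X)%E]esum1 ?adde0; last first.
  by case=> [s [_ []]|t _] //=; exists s.
rewrite setTI (@reindex_esum _ _ _ [set: S] (range inl) inl).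
  exact: mass_sum1.
by split=> // x y _ _ [].
Qed.

Lemma inr_mass_sum1 d : (\esum_(u in [set: S + T]) (inr_mass d u)%:E = 1)%E.
Proof.
rewrite (@esumID _ _ (range inr)) => [|u _]; last first.
  by rewrite lee_fin inr_mass_ge0.
rewrite [X in (_ + X)%E]esum1 ?adde0; last first.
  by case=> [s _|t [_ []]] //=; exists t.
rewrite setTI (@reindex_esum _ _ _ [set: T] (range inr) inr).
  exact: mass_sum1.
by split=> // x y _ _ [].
Qed.

Definition distr_inl (d : distr R S) : distr R (S + T)%type :=
  Distr (inl_mass_ge0 d) (inl_mass_sum1 d).

Definition distr_inr (d : distr R T) : distr R (S + T)%type :=
  Distr (inr_mass_ge0 d) (inr_mass_sum1 d).

End DirectSumDistr.

Record lmc (R : realType) (AP : countType) := LMC {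
  state : countType;
  trans : state -> distr R state;
  init : state;
  label : state -> set AP }.

Section LMCTheory.
Context (R : realType) (AP : countType).
Implicit Types (M N : lmc R AP) (eps delta : R).

Definition finite_lmc M : Prop := finite_set [set: state M].

(* The initial state of a direct sum is irrelevant; we take that of [M]. *)
Definition direct_sum M N : lmc R AP :=
  @LMC R AP (state M + state N)%type
    (fun u => match u with
              | inl s => distr_inl (state N) (trans s)
              | inr t => distr_inr (state M) (trans t)
              end)
    (inl (init M))
    (fun u => match u with inl s => label s | inr t => label t end).

Definition rel_image (S : Type) (Q : S -> S -> Prop) (A : set S) : set S :=
  [set t | exists2 s, A s & Q s t].

Definition eps_bisimulation eps M (Q : state M -> state M -> Prop) : Prop :=
  [/\ Reflexive Q, Symmetric Q &
      forall s t, Q s t ->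
        label s = label t /\
        forall A : set (state M),
          (probm (trans s) A <= probm (trans t) (rel_image Q A) + eps%:E)%E].

Definition eps_bisimilar_states eps M (s t : state M) : Prop :=
  exists2 Q : state M -> state M -> Prop, eps_bisimulation eps Q & Q s t.

Definition eps_bisimilar eps M N : Prop :=
  @eps_bisimilar_states eps (direct_sum M N) (inl (init M)) (inr (init N)).

Definition bisimulation M (Q : state M -> state M -> Prop) : Prop :=
  Equivalence Q /\
  forall s t, Q s t ->
    label s = label t /\
    forall u : state M,
      probm (trans s) [set v | Q u v] = probm (trans t) [set v | Q u v].

Definition with_trans M (P' : state M -> distr R (state M)) : lmc R AP :=
  LMC P' (init M) (@label R AP M).

Definition is_perturbation delta M (P' : state M -> distr R (state M)) : Prop :=
  forall s, (l1_dist (trans s) (P' s) <= delta%:E)%E.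

Definition perturbed_bisimulation delta M (Q : state M -> state M -> Prop)
  : Prop :=
  exists2 P' : state M -> distr R (state M),
    is_perturbation delta P' & @bisimulation (with_trans P') Q.

Definition perturbed_bisimilar_states delta M (s t : state M) : Prop :=
  exists2 Q : state M -> state M -> Prop, perturbed_bisimulation delta Q & Q s t.

Definition perturbed_bisimilar delta M N : Prop :=
  @perturbed_bisimilar_states delta (direct_sum M N)
    (inl (init M)) (inr (init N)).

End LMCTheory.

(* Main.v *)
(** A ladder of states [s_i] leaving the label [ap0] with probability
    [min 1 (i * eps)] is climbed in steps that cost only [eps] each, but an
    equivalence relation that identifies neighbouring rungs identifies the
    bottom with the top, where these probabilities are 0 and 1. The two chains
    force neighbouring rungs to be identified: they have states [x_k] that move
    with probability 1/2 to [x_(k+1)] and with probability 1/2 to a rung,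
    [s_(ceil (k/2))] in [M] and [s_(floor (k/2))] in [N]. A perturbation within
    [L^1] distance 1/4 changes the mass of any set by at most 1/8, too little
    to separate such halves. *)
Require Import Defs.
From mathcomp Require Import all_boot all_order all_algebra.
From mathcomp Require Import all_classical all_reals.
From mathcomp Require Import ereal esum lra zify.
From Stdlib Require Import RelationClasses.
Import Order.TTheory GRing.Theory Num.Theory.
Local Open Scope classical_set_scope.
Local Open Scope ring_scope.

Set Implicit Arguments.
Unset Strict Implicit.
Unset Printing Implicit Defensive.

(** * Masses of sets, [L^1] distance and two-point distributions *)

Section DistrTheory.
Context (R : realType) (S : countType).
Implicit Types (d : distr R S) (A : set S).

Lemma probm_setC d A : (probm d A + probm d (~` A) = 1)%E.
Proof.
rewrite -[RHS](mass_sum1 d) (esumID A) ?setTI//.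
by move=> s _; rewrite lee_fin mass_ge0.
Qed.

Lemma probm_ge0 d A : (0 <= probm d A)%E.
Proof. by apply: esum_ge0 => s _; rewrite lee_fin mass_ge0. Qed.

Lemma probm_le1 d A : (probm d A <= 1)%E.
Proof. by rewrite -(probm_setC d A) leeDl// probm_ge0. Qed.

Lemma probm_fin_num d A : probm d A \is a fin_num.
Proof.
by rewrite ge0_fin_numE ?probm_ge0// (le_lt_trans (probm_le1 d A))// ltry.
Qed.

Lemma l1_distC d d' : l1_dist d d' = l1_dist d' d.
Proof. by apply: eq_esum => s _; rewrite distrC. Qed.

Lemma probm_le_l1_on d d' A :
  (probm d A <= probm d' A + \esum_(s in A) `|d s - d' s|%:E)%E.
Proof.
rewrite -esumD => [||s _]; first last.
- by rewrite lee_fin.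
- by move=> s _; rewrite lee_fin mass_ge0.
apply: le_esum => s _; rewrite -EFinD lee_fin -lerBlDl.
exact: ler_norm.
Qed.

(* The differences on [A] and on its complement have equal size, which is why
   only half of the [L^1] distance is lost. *)
Lemma probm_le_l1_dist d d' A (delta : R) :
  (l1_dist d d' <= delta%:E)%E ->
  (probm d A <= probm d' A + (delta / 2)%:E)%E.
Proof.
move=> dd'; have := probm_le_l1_on d d' A.
have := probm_le_l1_on d' d (~` A); have := probm_setC d A.
have := probm_setC d' A.
have : l1_dist d d' = (\esum_(s in A) `|d s - d' s|%:E +
                       \esum_(s in ~` A) `|d' s - d s|%:E)%E.
  under [X in (_ + X)%E]eq_esum do rewrite distrC.
  by rewrite /l1_dist (esumID A) ?setTI// => s _; rewrite lee_fin.
move=> dE; move: dd'; rewrite dE.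
have : (0 <= \esum_(s in ~` A) `|d' s - d s|%:E)%E.
  by apply: esum_ge0 => s _; rewrite lee_fin.
have : (0 <= \esum_(s in A) `|d s - d' s|%:E)%E.
  by apply: esum_ge0 => s _; rewrite lee_fin.
rewrite -(fineK (probm_fin_num d A)) -(fineK (probm_fin_num d' A)).
rewrite -(fineK (probm_fin_num d (~` A))) -(fineK (probm_fin_num d' (~` A))).
case: (esum A _) => [a||]; case: (esum (~` A) _) => [b||] //=.
rewrite -!EFinD !lee_fin => a0 b0 ab [h1] [h2] h3 h4; lra.
Qed.

Lemma esum_point (c : R) (u : S) A : 0 <= c ->
  (\esum_(w in A) (c * (w == u)%:R)%:E = (c * (u \in A)%:R)%:E)%E.
Proof.
move=> c0; rewrite (esumID [set u]); last first.
  by move=> w _; rewrite lee_fin mulr_ge0.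
rewrite [X in (_ + X)%E]esum1 ?adde0; last first.
  by move=> w [_ /eqP/negPf] ->; rewrite mulr0.
rewrite setIC esum_mkcondr esum_set1; last first.
  by case: ifP; rewrite ?lee_fin ?mulr_ge0.
by rewrite eqxx; case: ifP => // _; rewrite mulr0.
Qed.

Definition two_point_mass (c : R) (u v w : S) : R :=
  c * (w == u)%:R + (1 - c) * (w == v)%:R.

Lemma two_point_ge0 c u v : 0 <= c <= 1 ->
  forall w, 0 <= two_point_mass c u v w.
Proof.
by move=> /andP[c0 c1] w; rewrite addr_ge0// mulr_ge0// subr_ge0.
Qed.

Lemma esum_two_point c u v A : 0 <= c <= 1 ->
  (\esum_(w in A) (two_point_mass c u v w)%:E =
   (c * (u \in A)%:R + (1 - c) * (v \in A)%:R)%:E)%E.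
Proof.
move=> /andP[c0 c1]; have c1' : 0 <= 1 - c by rewrite subr_ge0.
rewrite EFinD -!esum_point//.
by rewrite -esumD => [|w _|w _]; rewrite ?lee_fin ?mulr_ge0.
Qed.

Lemma two_point_sum1 c u v : 0 <= c <= 1 ->
  (\esum_(w in [set: S]) (two_point_mass c u v w)%:E = 1)%E.
Proof. by move=> c01; rewrite esum_two_point// !in_setT !mulr1 addrC subrK. Qed.

Definition two_point c u v (c01 : 0 <= c <= 1) : distr R S :=
  Distr (two_point_ge0 u v c01) (two_point_sum1 u v c01).

End DistrTheory.

(** * Masses in direct sums and under perturbation *)

Lemma probm_distr_inl (R : realType) (S T : countType) (d : distr R S)
  (A : set (S + T)) : probm (distr_inl T d) A = probm d (inl @^-1` A).
Proof.
rewrite /probm (@esumID _ _ (range inl)) => [|u _]; last first.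
  by rewrite lee_fin mass_ge0.
rewrite [X in (_ + X)%E]esum1 ?adde0; last first.
  by case=> [s [_ []]|t _] //=; exists s.
rewrite (@reindex_esum _ _ _ (inl @^-1` A) (A `&` range inl) inl)//.
split; first by move=> s /= As; split=> //; exists s.
  by move=> x y _ _ [].
by move=> w [Aw [s _ sw]]; exists s => //=; rewrite sw.
Qed.

Lemma probm_distr_inr (R : realType) (S T : countType) (d : distr R T)
  (A : set (S + T)) : probm (distr_inr S d) A = probm d (inr @^-1` A).
Proof.
rewrite /probm (@esumID _ _ (range inr)) => [|u _]; last first.
  by rewrite lee_fin mass_ge0.
rewrite [X in (_ + X)%E]esum1 ?adde0; last first.
  by case=> [s _|t [_ []]] //=; exists t.
rewrite (@reindex_esum _ _ _ (inr @^-1` A) (A `&` range inr) inr)//.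
split; first by move=> s /= As; split=> //; exists s.
  by move=> x y _ _ [].
by move=> w [Aw [s _ sw]]; exists s => //=; rewrite sw.
Qed.

(** In the perturbed chain the class has the same mass from [s] and from [t]; going there from [s]
    and back to [t] costs [delta / 2] each time. *)
Lemma perturbed_class_mass (R : realType) (AP : countType) (delta : R)
    (M : lmc R AP) (Q : state M -> state M -> Prop) s t u :
  perturbed_bisimulation delta Q -> Q s t ->
  (probm (trans s) [set v | Q u v] <=
   probm (trans t) [set v | Q u v] + delta%:E)%E.
Proof.
move=> [P' pert [_ bisim]] /bisim[_ /(_ u) /= eqP'].
have := probm_le_l1_dist [set v | Q u v] (pert s).
rewrite eqP' => /le_trans; apply.
have := pert t; rewrite l1_distC => /(probm_le_l1_dist [set v | Q u v]) le2.
apply: le_trans (leeD2r _ le2) _.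
by rewrite -addeA -EFinD -splitr.
Qed.

Lemma perturbed_bisim_equiv (R : realType) (AP : countType) (delta : R)
    (M : lmc R AP) (Q : state M -> state M -> Prop) :
  perturbed_bisimulation delta Q -> Equivalence Q.
Proof. by case=> P' _ []. Qed.

Lemma perturbed_bisim_label (R : realType) (AP : countType) (delta : R)
    (M : lmc R AP) (Q : state M -> state M -> Prop) s t :
  perturbed_bisimulation delta Q -> Q s t -> label s = label t.
Proof. by case=> P' _ [_ bisim] /bisim[]. Qed.

(** * The ladder chains *)

Section Ladder.
Context (R : realType) (AP : countType) (eps : R) (m : nat).
Hypothesis eps_ge0 : 0 <= eps.

(* [(false, k)] is [x_k] and [(true, i)] is the rung [s_i]. *)
Local Notation node := (bool * 'I_m.+1)%type.

Definition leave_prob (a : node) : R :=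
  if a.1 then Num.min 1 (a.2%:R * eps) else 1 / 2.

Lemma leave_prob01 a : 0 <= leave_prob a <= 1.
Proof.
rewrite /leave_prob; case: a.1; last by lra.
by rewrite ge_min lexx le_min ler01 mulr_ge0.
Qed.

(** Leaving a rung leads to [x_0]. [ordS] is cyclic, so [x_m] also moves to [x_0]. *)
Definition x_succ (a : node) : node :=
  (false, if a.1 then ord0 else ordS a.2).

(** A rung that is not left loops. The map [f] is the only difference between the two chains. *)
Definition s_succ (f : 'I_m.+1 -> 'I_m.+1) (a : node) : node :=
  (true, if a.1 then a.2 else f a.2).

(** Rungs carry all of [AP], so any [ap0] tells them from the [x] nodes. *)
Definition ladder (f : 'I_m.+1 -> 'I_m.+1) : lmc R AP :=
  @LMC R AP node
    (fun a => two_point (x_succ a) (s_succ f a) (leave_prob01 a))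
    (false, ord0)
    (fun a => if a.1 then [set: AP] else set0).

Lemma finite_ladder f : finite_lmc (ladder f).
Proof. exact: (@finite_finset node). Qed.

(** * The direct sum of two ladders and its [eps]-bisimulation *)

Section Sum.
Context (f g : 'I_m.+1 -> 'I_m.+1).

Let L : lmc R AP := direct_sum (ladder f) (ladder g).

Definition node_of (u : node + node) : node :=
  match u with inl a => a | inr a => a end.

Definition sum_x_succ (u : node + node) : node + node :=
  match u with inl a => inl (x_succ a) | inr a => inr (x_succ a) end.

Definition sum_s_succ (u : node + node) : node + node :=
  match u with inl a => inl (s_succ f a) | inr a => inr (s_succ g a) end.

Lemma probm_ladder_sum (u : state L) (A : set (state L)) :
  (probm (trans u) A =
   (leave_prob (node_of u) * (sum_x_succ u \in A)%:R +
    (1 - leave_prob (node_of u)) * (sum_s_succ u \in A)%:R)%:E)%E.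
Proof.
case: u => a /=; rewrite ?probm_distr_inl ?probm_distr_inr /probm /=;
by rewrite (esum_two_point _ _ _ (leave_prob01 a)).
Qed.

Lemma label_ladder_sum (u : state L) :
  label u = if (node_of u).1 then [set: AP] else set0.
Proof. by case: u. Qed.

(** The boolean [(node_of u).1] is read as 0 or 1: [x] nodes need equal indices, rungs may be one
    step apart. Which chain a node lies in is ignored. *)
Definition close_nodes (u v : node + node) : Prop :=
  [/\ (node_of u).1 = (node_of v).1,
      ((node_of u).2 <= (node_of v).2 + (node_of u).1)%N &
      ((node_of v).2 <= (node_of u).2 + (node_of u).1)%N].

Lemma leave_prob_close u v : close_nodes u v ->
  leave_prob (node_of u) <= leave_prob (node_of v) + eps.
Proof.
move=> [uv uv2 _]; rewrite /leave_prob -uv.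
case: (node_of u).1 uv2 => uv2; last by rewrite lerDl.
have : ((node_of u).2%:R <= (node_of v).2%:R + 1 :> R).
  by rewrite natr1 ler_nat; move: uv2; rewrite /= addn1.
move=> /(ler_wpM2r eps_ge0); rewrite mulrDl mul1r => le_eps.
set a := _ * eps in le_eps *; set b := _ * eps in le_eps *.
by move: eps_ge0; case: (leP 1 a) => ha; case: (leP 1 b) => hb; lra.
Qed.

Lemma close_nodes_sym u v : close_nodes u v -> close_nodes v u.
Proof. by move=> [uv h1 h2]; split; rewrite -?uv. Qed.

Lemma close_nodes_x_succ u v :
  close_nodes u v -> close_nodes (sum_x_succ u) (sum_x_succ v).
Proof.
case: u v => -[[] i] [] [[] j] [//= _ h1 h2]; split => //=;
by rewrite /x_succ/= !addn0 in h1 h2 *; have -> : i = j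
  by apply/val_inj/anti_leq; rewrite h1.
Qed.

Hypothesis fg_close : forall i, (g i <= f i <= (g i).+1)%N.

(** Rungs stay put; from a common index [i] the targets [f i] and [g i] are at most one rung apart
    by [fg_close]. *)
Lemma close_nodes_s_succ u v :
  close_nodes u v -> close_nodes (sum_s_succ u) (sum_s_succ v).
Proof.
case: u v => -[[] i] [] [[] j] [//= _ h1 h2]; split => //=;
rewrite ?addn0 in h1 h2 *; rewrite ?addn1 in h1 h2 *; rewrite // ?addn1;
have -> : i = j by [apply/val_inj/anti_leq; rewrite h1];
by have := fg_close j; lia.
Qed.

(** Successors of close nodes are close, so each successor of [u] in [A] has its counterpart in the
    image of [A]. It remains to compare two-point masses whose weights differ by at most [eps]. *)
Lemma eps_bisim_close : @eps_bisimulation R AP eps L close_nodes.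
Proof.
split=> [u|u v|u v uv]; [by split; rewrite ?leq_addr | exact: close_nodes_sym|].
split=> [|A]; first by rewrite !label_ladder_sum; case: uv => ->.
have img w w' : close_nodes w w' ->
    ((w \in A) <= (w' \in rel_image close_nodes A))%N.
  move=> ww'; case: (boolP (w \in A)) => // /set_mem Aw.
  by rewrite mem_set//; exists w.
rewrite !probm_ladder_sum -EFinD lee_fin.
have := leave_prob_close uv; have := leave_prob_close (close_nodes_sym uv).
have /andP[] := leave_prob01 (node_of u).
have /andP[] := leave_prob01 (node_of v).
have := img _ _ (close_nodes_x_succ uv); have := img _ _ (close_nodes_s_succ uv).
by case: (_ \in A); case: (_ \in A); case: (_ \in _); case: (_ \in _) => //=;
  move: eps_ge0; lra.
Qed.

(** * Identifications forced by a 1/4-perturbed bisimulation *)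

Context (Q : node + node -> node + node -> Prop).
Hypothesis Qpert : @perturbed_bisimulation R AP (1 / 4) L Q.
Hypothesis ap0 : AP.

Lemma forced_label u v : Q u v -> (node_of u).1 = (node_of v).1.
Proof.
move=> /(perturbed_bisim_label Qpert); rewrite !label_ladder_sum.
case: (node_of u).1; case: (node_of v).1 => // h.
- by have : (set0 : set AP) ap0 by rewrite -h.
- by have : (set0 : set AP) ap0 by rewrite h.
Qed.

(** By the labels, the class of an [x] node contains no rung, so only the [x] successors contribute
    to its mass. If they are unrelated, the bound becomes [leave_prob (node_of u) <= 1 / 4]. *)
Lemma forced_x_succ u v : Q u v ->
  leave_prob (node_of u) <=
    leave_prob (node_of v) * `[< Q (sum_x_succ u) (sum_x_succ v) >]%:R + 1 / 4.
Proof.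
move=> /(@perturbed_class_mass _ _ _ L _ _ _ (sum_x_succ u) Qpert).
rewrite !probm_ladder_sum -EFinD lee_fin.
have eqQ := perturbed_bisim_equiv Qpert.
rewrite [sum_x_succ u \in _]mem_set; last exact: reflexivity.
have xs w : (sum_s_succ w \in [set t | Q (sum_x_succ u) t]) = false.
  by apply/negbTE/negP => /set_mem/= /forced_label; case: u w => ? [].
by rewrite !xs mulr1 !mulr0 !addr0.
Qed.

Lemma forced_s_succ u v : Q u v ->
  1 - leave_prob (node_of u) <=
    (1 - leave_prob (node_of v)) * `[< Q (sum_s_succ u) (sum_s_succ v) >]%:R
    + 1 / 4.
Proof.
move=> /(@perturbed_class_mass _ _ _ L _ _ _ (sum_s_succ u) Qpert).
rewrite !probm_ladder_sum -EFinD lee_fin.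
have eqQ := perturbed_bisim_equiv Qpert.
rewrite [sum_s_succ u \in _]mem_set; last exact: reflexivity.
have xs w : (sum_x_succ w \in [set t | Q (sum_s_succ u) t]) = false.
  by apply/negbTE/negP => /set_mem/= /forced_label; case: u w => ? [].
by rewrite !xs mulr1 !mulr0 !add0r.
Qed.

Hypothesis Qinit : Q (inl (false, ord0)) (inr (false, ord0)).

Lemma ordS_inord (i : 'I_m.+1) k : k.+1 = i -> ordS (inord k) = i.
Proof.
move=> ki; apply: val_inj => /=; rewrite inordK; last first.
  by rewrite (ltn_trans _ (ltn_ord i))// -ki.
by rewrite ki modn_small.
Qed.

(** Induction on the index: unrelated successors would give 1/2 <= 1/4. *)
Lemma forced_x i : Q (inl (false, i)) (inr (false, i)).
Proof.
move: {2}(val i) (erefl (val i)) => k; elim: k i => [|k IH] i ik.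
  by have -> : i = ord0 by apply: val_inj.
have km : (k < m.+1)%N by rewrite (ltn_trans _ (ltn_ord i))// ik.
have /forced_x_succ := IH (inord k) (inordK km).
rewrite /leave_prob /= /x_succ /= (ordS_inord (esym ik)).
by case: asboolP => // _; rewrite mulr0 => h; exfalso; move: h; lra.
Qed.

Lemma forced_link i : Q (inl (true, f i)) (inr (true, g i)).
Proof.
have /forced_s_succ := forced_x i.
rewrite /leave_prob /= /s_succ /=.
by case: asboolP => // _; rewrite mulr0 => h; exfalso; move: h; lra.
Qed.

Hypothesis f0 : f ord0 = ord0.
Hypothesis alternating : forall i : 'I_m.+1, (i < m)%N ->
  f (ordS i) = f i \/ g (ordS i) = g i.

(** By [alternating], the links at consecutive indices share a rung, so transitivity carries the
    class of the bottom rung along all links. *)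
Lemma forced_rung i :
  Q (inl (true, ord0)) (inl (true, f i)) /\
  Q (inl (true, ord0)) (inr (true, g i)).
Proof.
have eqQ := perturbed_bisim_equiv Qpert.
(* The link at [j] makes either membership imply the other, so the induction may follow whichever of
   [f] and [g] stands still. *)
have both j : Q (inl (true, ord0)) (inl (true, f j)) \/
              Q (inl (true, ord0)) (inr (true, g j)) ->
    Q (inl (true, ord0)) (inl (true, f j)) /\
    Q (inl (true, ord0)) (inr (true, g j)).
  have link := forced_link j; case=> h; split=> //.
    by transitivity (inl (true, f j) : node + node).
  by transitivity (inr (true, g j) : node + node) => //; symmetry.
apply: (both i); move: {2}(val i) (erefl (val i)) => k; elim: k i => [|k IH] i ik.
  by left; have -> : i = ord0 by [apply: val_inj]; rewrite f0; reflexivity.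
have km : (k < m)%N by rewrite -ltnS -ik ltn_ord.
have kE : (inord k : 'I_m.+1) = k :> nat by rewrite inordK// ltnS ltnW.
have [fk gk] := both _ (IH (inord k) kE).
have := alternating (i := inord k); rewrite kE => /(_ km).
by rewrite (ordS_inord (esym ik)) => -[->|->]; [left|right].
Qed.

(** Otherwise rung [g i] stays with probability 0 and the bottom rung, related to it, with
    probability 1, giving 1 <= 1/4. *)
Lemma top_rung_short i : (g i)%:R * eps < 1.
Proof.
rewrite ltNge; apply/negP => top.
have [_ /forced_s_succ] := forced_rung i.
rewrite /leave_prob /= mul0r min_r ?ler01// min_l//.
by rewrite subrr mul0r; lra.
Qed.

End Sum.
End Ladder.

(** * Choice of the two ladders *)

Theorem theorem4p7 (R : realType) (AP : countType) (ap0 : AP) (eps : R)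
    (eps_gt0 : 0 < eps) (eps_le : eps <= 1 / 4) :
  exists M N : lmc R AP,
    [/\ finite_lmc M, finite_lmc N, eps_bisimilar eps M N &
        ~ perturbed_bisimilar (1 / 4) M N].
Proof.
have eps_ge0 := ltW eps_gt0.
(* Archimedean choice making rung [n] leave with probability 1. *)
set n := Num.bound eps^-1.
have n_eps : 1 <= n%:R * eps.
  rewrite -ler_pdivrMr// div1r ltW// archi_boundP// invr_ge0//.
(* Indices run up to [2n], so that halving reaches rung [n]. *)
pose f (i : 'I_n.*2.+1) : 'I_n.*2.+1 := inord (uphalf i).
pose g (i : 'I_n.*2.+1) : 'I_n.*2.+1 := inord (half i).
have fE i : f i = uphalf i :> nat.
  by rewrite inordK//; have := ltn_ord i; lia.
have gE i : g i = half i :> nat.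
  by rewrite inordK//; have := ltn_ord i; lia.
exists (ladder AP eps_ge0 f), (ladder AP eps_ge0 g); split.
- exact: finite_ladder.
- exact: finite_ladder.
- exists (@close_nodes n.*2) => //; apply: eps_bisim_close => i.
  by rewrite fE gE; lia.
case=> Q Qpert Qinit.
have f0 : f ord0 = ord0 by apply: val_inj; rewrite [LHS]fE.
have alt (i : 'I_n.*2.+1) : (i < n.*2)%N ->
    f (ordS i) = f i \/ g (ordS i) = g i.
  move=> i_lt; have iS : ordS i = i.+1 :> nat by rewrite /= modn_small.
  (* From [i] to [i + 1] the ceiling of the half is constant for odd [i], the floor for even [i]. *)
  have [io|ie] := boolP (odd i); [left|right]; apply: val_inj.
  - by rewrite [LHS]fE [RHS]fE iS; lia.
  - by rewrite [LHS]gE [RHS]gE iS; lia.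
have := top_rung_short Qpert ap0 Qinit f0 alt ord_max.
by rewrite gE /= doubleK ltNge n_eps.
Qed.
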